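(* Let $G=(V,E,F)$ be a graph on an oriented surface $\Sigma$ and let $G^*$ be its dual graph. The map $BAO(G)\to TCO(G^* )$ sending $\mathfrak{o}$ to its dual orientation $\mathfrak{o}^*$ is bijective.
   Context: Graphs may have loops and multiple edges. A graph on a surface $G=(V,E,F)$ is a graph $(V,E)$ cellularly embedded in a closed oriented (not necessarily connected) surface $\Sigma$, i.e. the complement $\Sigma\setminus G$ is a disjoint union of discs; these discs are the faces, and $F$ is the set of faces. Equivalently, $G$ is an orientable ribbon graph. Dual graph: $G^*$ is the graph on the same surface $\Sigma$ having one vertex for each face of $G$, one face for each vertex of $G$, and for each edge $e$ of $G$ one dual edge $e^*$ crossing $e$ and joining the (possibly equal) faces on the two sides of $e$. An orientation of $G$ assigns a direction to each edge. The dual orientation $\mathfrak{o}^*$ of an orientation $\mathfrak{o}$ of $G$ is the orientation of $G^*$ such that for each edge $e$ the pair of directed edges $(\overrightarrow{e},\overrightarrow{e}^{*})$ is a positively oriented ordered pair with respect to the orientation of $\Sigma$. Totally cyclic orientation: an orientation such that every edge is contained in a directed cycle (a directed loop counts as a directed cycle). $TCO(H)$ denotes the set of totally cyclic orientations of $H$. Boundary: for $F'\subseteq F$, $\partial F'$ is the set of edges having two distinct adjacent faces exactly one of which belongs to $F'$. Each edge of $\partial F'$ receives a natural direction, giving $\overrightarrow{\partial F'}$: the direction induced by the orientation of its adjacent face $f\in F'$ as a submanifold of $\Sigma$. For an orientation $\mathfrak{o}$, the vector $\overrightarrow{\partial_{\mathfrak{o}}F'}\in\{0,\pm1\}^E$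 has $e$-entry $0$ if $e\notin\partial F'$, $1$ if the direction of $e$ in $\overrightarrow{\partial F'}$ agrees with $\mathfrak{o}$, and $-1$ if it disagrees. A nonempty boundary $\partial F'$ is coherently oriented with respect to $\mathfrak{o}$ if the nonzero entries of $\overrightarrow{\partial_{\mathfrak{o}}F'}$ are all $+1$ or all $-1$. Boundary acyclic orientation: an orientation of $G$ with respect to which there is no coherently oriented (nonempty) boundary. $BAO(G)$ denotes the set of boundary acyclic orientations of $G$. *)

(* Defs.v *)
From HB Require Import structures.
From mathcomp Require Import all_boot all_order all_algebra all_fingroup.
From mathcomp Require classical_sets.

Set Implicit Arguments.
Unset Strict Implicit.
Unset Printing Implicit Defensive.

Local Open Scope ring_scope.

Definition cycles (T : finType) (s : {perm T}) : finType :=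
  {A : {set T} | A \in porbits s}.

Lemma porbit_in_porbits (T : finType) (s : {perm T}) (x : T) :
  porbit s x \in porbits s.
Proof. exact: imset_f. Qed.

Definition cycle_of (T : finType) (s : {perm T}) (x : T) : cycles s :=
  Sub (porbit s x) (porbit_in_porbits s x).

(* A graph cellularly embedded in a closed oriented surface, encoded as an
   orientable ribbon graph (combinatorial map).  A dart is an edge together
   with a direction, and is attached to its tail; [rot] sends a dart to the
   next one counterclockwise around its tail, [opp] reverses the direction.
   A vertex with no incident edge is alone on a sphere component of the
   surface; such vertices are invisible to the darts and are listed in
   [isolated]. *)
Record ribbon_graph := RibbonGraph {
  dart : finType;
  isolated : finType;
  rot : {perm dart};
  opp : {perm dart};
  oppK : involutive opp;
  opp_neq : forall d, opp d != d }.

Section RibbonGraph.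
Variable G : ribbon_graph.
Implicit Types (d : dart G).

(* The next dart along the boundary of the face lying to the left of d:
   d |-> rot^-1 (opp d)  (products of permutations apply the left factor
   first). *)
Definition face_perm : {perm dart G} := (opp G * (rot G)^-1)%g.

Definition vertex : finType := (cycles (rot G) + isolated G)%type.
Definition edge : finType := cycles (opp G).
Definition face : finType := (cycles face_perm + isolated G)%type.

Definition tail d : vertex := inl (cycle_of (rot G) d).
Definition head d : vertex := tail (opp G d).
Definition edge_of d : edge := cycle_of (opp G) d.
Definition left_face d : face := inl (cycle_of face_perm d).
Definition right_face d : face := left_face (opp G d).

Definition orientation : finType :=
  {o : {ffun edge -> dart G} | [forall e, o e \in val e]}.

Definition direction (o : orientation) (e : edge) : dart G := val o e.

Definition adjacent_faces (e : edge) : {set face} :=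
  [set left_face d | d in val e].

Definition boundary (F' : {set face}) : {set edge} :=
  [set e | (#|adjacent_faces e| == 2)
           && (#|adjacent_faces e :&: F'| == 1)]%N.

(* The boundary orientation induced by an oriented face keeps that face on
   the left. *)
Definition directed_boundary (F' : {set face}) : {set dart G} :=
  [set d | (edge_of d \in boundary F') && (left_face d \in F')].

Definition boundary_vector (o : orientation) (F' : {set face}) (e : edge) :
    int :=
  if e \notin boundary F' then 0
  else if direction o e \in directed_boundary F' then 1 else -1.

Definition coherently_oriented (o : orientation) (F' : {set face}) : Prop :=
  boundary F' != set0 /\
  ((forall e, boundary_vector o F' e != 0 -> boundary_vector o F' e = 1) \/
   (forall e, boundary_vector o F' e != 0 -> boundary_vector o F' e = -1)).

Definition boundary_acyclic (o : orientation) : Prop :=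
  ~ exists F' : {set face}, coherently_oriented o F'.

Definition directed_cycle (o : orientation) (c : seq (dart G)) : Prop :=
  [/\ c != [::],
      all (fun d => direction o (edge_of d) == d) c,
      path.cycle (fun d d' => head d == tail d') c
    & uniq (map tail c)].

Definition totally_cyclic (o : orientation) : Prop :=
  forall e : edge, exists c : seq (dart G),
    directed_cycle o c /\ e \in map edge_of c.

Definition BAO : classical_sets.set orientation := boundary_acyclic.
Definition TCO : classical_sets.set orientation := totally_cyclic.

(* The dual graph has the same darts: d is now the dart at the centre of the
   face to the left of d that crosses the edge of d, from left to right.
   The next such dart counterclockwise around this centre crosses the next
   dart along the boundary of the face. *)
Definition dual : ribbon_graph :=
  @RibbonGraph (dart G) (isolated G) face_perm (opp G) (@oppK G) (@opp_neq G).

End RibbonGraph.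

Arguments BAO : clear implicits.
Arguments TCO : clear implicits.

Lemma porbit_conjg (T : finType) (s a : {perm T}) (x : T) :
  porbit (s ^ a)%g (a x) = a @: porbit s x.
Proof.
apply/setP => y; apply/porbitP/imsetP => [[i ->]|[z /porbitP[i ->] ->]].
  by exists ((s ^+ i)%g x); rewrite ?mem_porbit // -conjXg permJ.
by exists i; rewrite -conjXg permJ.
Qed.

Lemma face_perm_dual (G : ribbon_graph) :
  face_perm (dual G) = ((rot G) ^ (opp G))%g.
Proof.
have oppV : (opp G)^-1%g = opp G.
  by apply/permP => x; apply: (@perm_inj _ (opp G)); rewrite permKV oppK.
by rewrite /face_perm /= invMg invgK conjgE oppV.
Qed.

Section DualOrientation.
Variable G : ribbon_graph.

Definition dual_edge (e : edge G) : edge (dual G) := e.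

(* (d, d^* ) is positively oriented when d^* crosses d from right to left,
   whence the reversal. *)
Definition dual_dart (d : dart G) : dart (dual G) := opp G d.

Lemma edge_of_dual_dart d : edge_of (dual_dart d) = dual_edge (edge_of d).
Proof.
apply/val_inj/eqP; rewrite /= eq_porbit_mem.
exact: (mem_porbit (opp G) 1 d).
Qed.

Lemma tail_dual_dart d : tail (dual_dart d) = right_face d.
Proof. by []. Qed.

Lemma head_dual_dart d : head (dual_dart d) = left_face d.
Proof. by rewrite /head /= /dual_dart oppK. Qed.

Lemma left_face_dual_dart d d' :
  left_face (dual_dart d) = left_face (dual_dart d') <-> tail d = tail d'.
Proof.
have E x : porbit (face_perm (dual G)) (dual_dart x)
             = opp G @: porbit (rot G) x.
  by rewrite face_perm_dual porbit_conjg.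
have inlE A B (u v : A) : (inl u = inl v :> A + B) <-> u = v.
  by split=> [[]|->].
have cycE (T : finType) (s : {perm T}) x y :
    cycle_of s x = cycle_of s y <-> porbit s x = porbit s y.
  by split=> [[]//|h]; apply: val_inj.
rewrite /left_face /tail !inlE !cycE !E.
by split=> [/(imset_inj (@perm_inj _ _))|->].
Qed.

Lemma dual_directionP (o : orientation G) :
  [forall e : edge (dual G),
    [ffun e : edge (dual G) => dual_dart (direction o e)] e \in val e].
Proof.
apply/forallP => e; rewrite ffunE.
have /forallP/(_ e) : [forall e, val o e \in val e] := valP o.
rewrite /dual_dart /direction.
have /imsetP[x _ ->] := valP e.
by case/porbitP => i ->; rewrite -permM -expgSr mem_porbit.
Qed.

Definition dual_orientation (o : orientation G) : orientation (dual G) :=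
  Sub [ffun e : edge (dual G) => dual_dart (direction o e)]
      (dual_directionP o).

Lemma direction_dual (o : orientation G) (e : edge G) :
  direction (dual_orientation o) (dual_edge e) = dual_dart (direction o e).
Proof. by rewrite /direction /= ffunE. Qed.

End DualOrientation.

(* Main.v *)
From mathcomp Require Import all_boot all_algebra all_fingroup.
From mathcomp Require Import classical_sets functions.
Require Import Defs.

(** A boundary of [G] is a cut of the dual graph [G^*], and it is coherently
    oriented exactly when the dual orientation directs all edges of this cut
    the same way.  No directed cycle can meet such a cut.  Conversely, if an
    edge [e] of [G^*] lies on no directed cycle, then the set of vertices
    reachable from the head of [e] does not contain its tail, hence defines a
    directed cut containing [e]. *)

Set Implicit Arguments.
Unset Strict Implicit.
Unset Printing Implicit Defensive.

Section DirectedCycles.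
Variables (H : ribbon_graph) (o : orientation H).
Implicit Types (d : dart H) (u v : vertex H).

Definition positive d : bool := direction o (edge_of d) == d.

Lemma edge_of_direction (e : edge H) : edge_of (direction o e) = e.
Proof.
have /forallP/(_ e) : [forall e, val o e \in val e] := valP o.
rewrite -/(direction o e); have /imsetP[x _ ex] := valP e.
rewrite ex => dx; apply/val_inj/eqP; rewrite /= ex.
by rewrite eq_porbit_mem.
Qed.

Lemma positive_direction (e : edge H) : positive (direction o e).
Proof. by rewrite /positive edge_of_direction. Qed.

(** Following the rest of the cycle from [head d] leads back to [tail d], and each dart on the way
    preserves [P]. This is what forbids a directed cycle from crossing a directed cut. *)
Lemma directed_cycle_closed (c : seq (dart H)) (P : pred (vertex H)) d :
  directed_cycle o c -> d \in c ->
  (forall d', positive d' -> P (tail d') -> P (head d')) ->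
  P (head d) -> P (tail d).
Proof.
case=> _ pos_c cyc_c _ dc closedP; have [i s rot_c] := rot_to dc.
have {cyc_c}: path.cycle (fun d d' => head d == tail d') (d :: s).
  by rewrite -rot_c rot_cycle.
have {pos_c rot_c}: all positive s.
  apply/allP => x xs; apply: (allP pos_c).
  by rewrite -(mem_rot i) rot_c inE xs orbT.
(* Only the starting dart of the path is generalized, to [y]; the closing dart [d] stays fixed. *)
rewrite /=; elim: s {1 3}d {dc} => [|x s IHs] y /=.
  by rewrite andbT => _ /eqP->.
case/andP=> pos_x pos_s /andP[/eqP yx] xs Py.
by apply: (IHs x) => //; apply: closedP; rewrite -?yx.
Qed.

Definition step u v : bool :=
  [exists d, [&& positive d, tail d == u & head d == v]].

Lemma step_dart d : positive d -> step (tail d) (head d).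
Proof. by move=> pos_d; apply/existsP; exists d; rewrite pos_d !eqxx. Qed.

(** Parallel edges leave a choice of dart at each step. Recording the tails as [belast] lets the
    absence of repeated vertices pass from [p] to the darts. *)
Lemma dart_path_of_vertex_path d (p : seq (vertex H)) :
  path step (head d) p ->
  exists c : seq (dart H),
    [/\ all positive c, path (fun d d' => head d == tail d') d c,
        map (@tail H) c = belast (head d) p
      & head (last d c) = last (head d) p].
Proof.
elim: p d => [|v p IHp] d /=; first by exists [::].
case/andP=> /existsP[x /and3P[pos_x /eqP tx /eqP hx]]; rewrite -hx => /IHp.
case=> c [pos_c path_c tail_c last_c]; exists (x :: c); split => //=.
- by rewrite pos_x.
- by rewrite tx eqxx.
- by rewrite tail_c tx.
Qed.

Lemma connect_directed_cycle d :
  positive d -> connect step (head d) (tail d) ->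
  exists c, directed_cycle o c /\ d \in c.
Proof.
move=> pos_d /connectP[p0 /shortenP[p path_p uniq_p _] {p0}] last_p.
have [c [pos_c path_c tail_c last_c]] := dart_path_of_vertex_path path_p.
exists (d :: c); split; last exact: mem_head.
split => //.
- exact/andP.
- by rewrite /= rcons_path path_c last_c -last_p eqxx.
(* Since [p] ends at [tail d], the tails of [d :: c] are the vertices of the simple path with the
   last one moved to the front. *)
- by rewrite /= tail_c last_p -rcons_uniq -lastI.
Qed.

End DirectedCycles.

Section Boundary.
Variable G : ribbon_graph.
Implicit Types (d : dart G) (F : {set face G}).

Lemma mem_edge_of d x : (x \in val (edge_of d)) = (x == d) || (x == opp G d).
Proof.
apply/porbitP/orP => [[i ->]|[]/eqP->]; last 2 first.
- by exists 0; rewrite expg0 perm1.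
- by exists 1; rewrite expg1.
elim: i => [|i IHi]; first by left; rewrite expg0 perm1.
rewrite expgSr permM; case: IHi => /eqP->; first by right.
by left; rewrite oppK.
Qed.

Lemma adjacent_facesE d :
  adjacent_faces (edge_of d) = [set left_face d; right_face d]%SET.
Proof.
apply/setP => f; rewrite !inE; apply/imsetP/orP => [[x]|].
  by rewrite mem_edge_of => /orP[]/eqP-> ->; [left | right].
by case=> /eqP->; [exists d | exists (opp G d)];
  rewrite ?mem_edge_of ?eqxx ?orbT.
Qed.

(** If both sides of [d] are the same face, the exclusive or vanishes, in accordance with the
    requirement of two distinct adjacent faces. *)
Lemma mem_boundary F d :
  (edge_of d \in boundary F) = (left_face d \in F) (+) (right_face d \in F).
Proof.
rewrite inE adjacent_facesE cards2.
have [->|neq_lr] := eqVneq (left_face d); first by rewrite addbb.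
rewrite /= finset.setIUl cardsU -finset.setIIl.
have card1I f : #|[set f] :&: F|%SET = (f \in F).
  have [fF|fF] := boolP (f \in F).
    by rewrite (finset.setIidPl _) ?cards1 ?finset.sub1set.
  by apply/eqP; rewrite cards_eq0 setI_eq0 disjoints1.
have /eqP-> : ([set left_face d] :&: [set right_face d] == finset.set0)%SET.
  by rewrite setI_eq0 disjoints1 inE.
by rewrite finset.set0I cards0 !card1I; do 2!case: (_ \in F).
Qed.

(** The right-hand side is the coboundary of the indicator function of [F]; coherence thus says that
    this function is monotone across all positive darts. *)
Lemma boundary_vectorE (o : orientation G) F d :
  positive o d ->
  boundary_vector o F (edge_of d) =
    ((left_face d \in F)%:Z - (right_face d \in F)%:Z)%R.
Proof.
move=> /eqP pos_d; rewrite /boundary_vector pos_d mem_boundary inE mem_boundary.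
by do 2!case: (_ \in F).
Qed.

End Boundary.

Section DualOrientation.
Variable G : ribbon_graph.
Implicit Types (o : orientation G) (d : dart G).

Lemma positive_dual o d :
  positive (dual_orientation o) (dual_dart d) = positive o d.
Proof.
by rewrite /positive edge_of_dual_dart direction_dual (inj_eq perm_inj).
Qed.

Lemma dual_orientation_inj : injective (@dual_orientation G).
Proof.
move=> o1 o2 eq_o; apply/val_inj/ffunP => e; apply: (@perm_inj _ (opp G)).
by rewrite -[LHS](direction_dual o1) eq_o [LHS]direction_dual.
Qed.

(** Both graphs have the same edges and [opp G] is an involution, so the preimage is obtained by
    reversing every chosen dart. *)
Lemma dual_orientation_surj (o : orientation (dual G)) :
  exists o', dual_orientation o' = o.
Proof.
have opp_dir : [forall e : edge G,
    [ffun e : edge G => opp G (direction o e)] e \in val e].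
  apply/forallP => e; rewrite ffunE -[in X in _ \in X](edge_of_direction o e).
  by rewrite mem_edge_of eqxx orbT.
exists (Sub [ffun e : edge G => opp G (direction o e)] opp_dir).
apply/val_inj/ffunP => e; rewrite [LHS]direction_dual /direction /=.
by rewrite ffunE; apply: oppK.
Qed.

Lemma boundary_acyclic_dual o :
  boundary_acyclic o -> totally_cyclic (dual_orientation o).
Proof.
move=> acyc_o e; pose d := direction o e; pose d' := dual_dart d.
have pos_d : positive o d by apply: positive_direction.
have ed : edge_of d = e by apply: edge_of_direction.
have pos_d' : positive (dual_orientation o) d' by rewrite positive_dual.
have [/(connect_directed_cycle pos_d')|] :=
  boolP (connect (step (dual_orientation o)) (head d') (tail d')).
  case=> c [cyc_c dc]; exists c; split=> //; apply/mapP; exists d' => //.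
  by rewrite edge_of_dual_dart ed.
rewrite head_dual_dart tail_dual_dart => unreached; case: acyc_o.
(* Faces of [G] are vertices of [dual G]: [F] collects those reachable from the head of [d']. *)
pose F := [set f : face G |
  connect (step (dual_orientation o)) (left_face d) f]%SET.
have dF : edge_of d \in boundary F.
  by rewrite mem_boundary !inE connect0 (negPf unreached).
exists F; split; first by apply/set0Pn; exists (edge_of d).
left=> x; rewrite -(edge_of_direction o x).
rewrite boundary_vectorE ?positive_direction //.
set y := direction o x; have pos_y : positive o y by apply: positive_direction.
(* The dual of a positive dart runs from its right face to its left face, so [F] is closed in this
   direction and the value -1 cannot occur. *)
have : right_face y \in F -> left_face y \in F.
  rewrite !inE => /connect_trans; apply; apply: connect1.
  by rewrite -tail_dual_dart -head_dual_dart step_dart ?positive_dual.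
by case: (right_face y \in F) => [->|_] //; case: (_ \in F).
Qed.

Lemma totally_cyclic_dual o :
  totally_cyclic (dual_orientation o) -> boundary_acyclic o.
Proof.
move=> cyc_o [F [/set0Pn[e eF]]].
have [c [cyc_c /mapP[d' dc ed']]] := cyc_o e.
pose d := opp G d'; have dd' : d' = dual_dart d by rewrite /dual_dart oppK.
have pos_d' : positive (dual_orientation o) d'.
  by case: cyc_c => _ /allP/(_ _ dc).
have pos_d : positive o d by rewrite -positive_dual -dd'.
have ed : e = edge_of d by rewrite ed' dd' edge_of_dual_dart.
(* Closure along the dual cycle, read in [G]; every dual dart has the form [dual_dart x] because
   [opp G] is an involution. *)
have closed (P : pred (face G)) :
    (forall x, positive o x -> P (right_face x) -> P (left_face x)) ->
    P (left_face d) -> P (right_face d).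
  move=> closedP; rewrite -tail_dual_dart -head_dual_dart -dd'.
  apply: (directed_cycle_closed cyc_c dc) => x; rewrite -[x](oppK (r := G)).
  rewrite [in positive _ _]positive_dual => pos_x.
  by rewrite tail_dual_dart head_dual_dart; apply: closedP.
move: eF; rewrite ed mem_boundary => eF.
case=> coh.
(* With all signs +1, [F] is closed from right to left, so the cycle forces both sides of [d] into
   [F]. *)
- have /(closed [pred f | f \in F]) : forall x, positive o x ->
      (right_face x \in F) -> (left_face x \in F).
    move=> x pos_x; have := coh (edge_of x); rewrite boundary_vectorE //.
    by case: (left_face _ \in F); case: (right_face _ \in F) => // /(_ isT).
  have := coh (edge_of d); rewrite boundary_vectorE //=.
  move: eF; case: (left_face _ \in F); case: (right_face _ \in F) => //= _;
    by [move=> _ /(_ isT) | move=> /(_ isT)].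
(* With all signs -1, the complement of [F] is closed instead. *)
- have /(closed [pred f | f \notin F]) : forall x, positive o x ->
      (right_face x \notin F) -> (left_face x \notin F).
    move=> x pos_x; have := coh (edge_of x); rewrite boundary_vectorE //.
    by case: (left_face _ \in F); case: (right_face _ \in F) => // /(_ isT).
  have := coh (edge_of d); rewrite boundary_vectorE //=.
  move: eF; case: (left_face _ \in F); case: (right_face _ \in F) => //= _;
    by [move=> /(_ isT) | move=> _ /(_ isT)].
Qed.

End DualOrientation.

Theorem theorem3p5 (G : ribbon_graph) :
  set_bij (BAO G) (TCO (dual G)) (@dual_orientation G).
Proof.
split.
- by move=> o /boundary_acyclic_dual.
- by move=> o1 o2 _ _ /dual_orientation_inj.
- move=> o cyc_o; have [o' eq_o] := dual_orientation_surj o.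
  by exists o' => //; apply: totally_cyclic_dual; rewrite eq_o.
Qed.
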